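(* Let $b\in\mathbb{R}^n\setminus\mathbb{Z}^n$. Then $$\operatorname{conv}(I_b)=G_b\cap\operatorname{aff}(I_b)=\operatorname{cl}(\operatorname{conv}(I_b))\cap\operatorname{aff}(I_b)=\big(\operatorname{conv}(I_b)+\mathbb{R}^{(\mathbb{R}^n)}_+\big)\cap\operatorname{aff}(I_b).$$
   Context: $\mathbb{R}^{(\mathbb{R}^n)}$ is the real vector space of functions $\mathbb{R}^n\to\mathbb{R}$ with finite support, $\mathbb{R}^{(\mathbb{R}^n)}_+$ the subset of its nonnegative functions. $M_b$ is the set of all pairs $(s,y)$ of finite-support functions $s:\mathbb{R}^n\to\mathbb{R}_+$, $y:\mathbb{R}^n\to\mathbb{Z}_+$ such that $\sum_{r} r\,s(r)+\sum_{p}p\,y(p)\in b+\mathbb{Z}^n$, and $I_b=\{y:(0,y)\in M_b\}$. A tuple $(\psi,\pi,\alpha)$ with $\psi,\pi:\mathbb{R}^n\to\mathbb{R}$, $\alpha\in\{-1,0,1\}$ is a valid tuple for $M_b$ if $\sum_r\psi(r)s(r)+\sum_p\pi(p)y(p)\ge\alpha$ for all $(s,y)\in M_b$. $Q_b$ is the set of all $(s,y)\in\mathbb{R}^{(\mathbb{R}^n)}_+\times\mathbb{R}^{(\mathbb{R}^n)}_+$ satisfying $\sum_r\psi(r)s(r)+\sum_p\pi(p)y(p)\ge\alpha$ for every valid tuple $(\psi,\pi,\alpha)$ for $M_b$, and $G_b=\{y\in\mathbb{R}^{(\mathbb{R}^n)}:(0,y)\in Q_b\}$. $\operatorname{conv}$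 is the convex hull, $\operatorname{aff}(C)$ is the set of affine combinations of points of $C$, and $\operatorname{cl}$ is the closure in the topology on $\mathbb{R}^{(\mathbb{R}^n)}$ induced by the norm $|y|_*=|y(0)|+\sum_{p\in\mathbb{R}^n}\|p\||y(p)|$, where $\|\cdot\|$ is the usual (Euclidean) norm on $\mathbb{R}^n$. *)

(* Defs.v *)
From HB Require Import structures.
From mathcomp Require Import all_boot all_order all_algebra.
From mathcomp Require Import all_classical all_reals all_analysis.

Set Implicit Arguments.
Unset Strict Implicit.
Unset Printing Implicit Defensive.

Import Order.TTheory GRing.Theory Num.Theory.
Import numFieldNormedType.Exports.

Local Open Scope classical_set_scope.
Local Open Scope ring_scope.

Section EuclideanNorm.
Variables (R : realType) (n : nat).
Implicit Types p : 'rV[R]_n.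

(* The norm `|p| that the library puts on 'rV[R]_n is the sup norm. *)
Definition enorm p : R := Num.sqrt (\sum_(i < n) p ord0 i ^+ 2).

Lemma enorm_ge0 p : 0 <= enorm p.
Proof. exact: sqrtr_ge0. Qed.

Lemma enorm_eq0 p : enorm p = 0 -> p = 0.
Proof.
have sq_ge0 i : 0 <= p ord0 i ^+ 2 by exact: sqr_ge0.
move=> /eqP; rewrite sqrtr_eq0 => le0.
have /eqP : \sum_(i < n) p ord0 i ^+ 2 = 0.
  by apply/eqP; rewrite eq_le le0 sumr_ge0.
rewrite psumr_eq0// => /allP p0; apply/rowP => i; rewrite mxE.
by apply/eqP; rewrite -sqrf_eq0; exact: (p0 i (mem_index_enum i)).
Qed.

End EuclideanNorm.

Section FiniteSupport.
Variables (R : realType) (n : nat).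
Local Notation V := 'rV[R]_n.

Definition finsupp : {pred V -> R} :=
  fun f => `[< finite_set (f @^-1` [set~ 0]) >].

(* The vector space R^(R^n). *)
Record finfct := FinFct { finfct_fun :> V -> R ; _ : finfct_fun \in finsupp }.

HB.instance Definition _ := [isSub for finfct_fun].
HB.instance Definition _ := [Choice of finfct by <:].

Lemma finsupp_submod_closed : submod_closed finsupp.
Proof.
split=> [|a f g]; first apply/asboolP.
  by rewrite (_ : _ @^-1` _ = set0)//; apply/seteqP; split=> p //=; apply.
move=> /asboolP ff /asboolP fg; apply/asboolP.
have ffg : finite_set ((f @^-1` [set~ 0]) `|` (g @^-1` [set~ 0])).
  by rewrite finite_setU.
apply: sub_finite_set ffg => p /= afg0.
have [fp0|fp0] := eqVneq (f p) 0; last by left; exact/eqP.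
by right=> gp0; apply: afg0; rewrite fctE /= scalrfctE fp0 gp0 scaler0 addr0.
Qed.

HB.instance Definition _ :=
  GRing.isSubmodClosed.Build R (V -> R) finsupp finsupp_submod_closed.
HB.instance Definition _ := [SubChoice_isSubLmodule of finfct by <:].

Implicit Types y z : finfct.

Lemma finfct_finite y : finite_set ((y : V -> R) @^-1` [set~ 0]).
Proof. by apply/asboolP; exact: (valP y). Qed.

Definition star_norm y : R :=
  `|y 0| + \sum_(p \in [set: V]) enorm p * `|y p|.

Lemma star_norm_finite y (F : V -> R) :
  finite_set ([set: V] `&` (fun p => F p * `|y p|) @^-1` [set~ 0]).
Proof.
rewrite setTI; apply: sub_finite_set (finfct_finite y) => p /= h yp0.
by apply: h; rewrite yp0 normr0 mulr0.
Qed.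

Lemma star_normD y z : star_norm (y + z) <= star_norm y + star_norm z.
Proof.
rewrite /star_norm addrACA lerD ?ler_normD//.
have fyz : finite_set (((y : V -> R) @^-1` [set~ 0]) `|`
                       ((z : V -> R) @^-1` [set~ 0])).
  by rewrite finite_setU; split; exact: finfct_finite.
set D := (X in finite_set X) in fyz.
have restr (u : finfct) : (u : V -> R) @^-1` [set~ 0] `<=` D ->
    \sum_(p \in [set: V]) enorm p * `|u p| =
    \sum_(p \in D) enorm p * `|u p|.
  move=> uD; apply/esym/fsbig_widen => // p [_ nDp] /=.
  have [->|up0] := eqVneq (u p) 0; first by rewrite normr0 mulr0.
  by exfalso; apply: nDp; apply: uD; exact/eqP.
rewrite (restr y) ?(restr z) ?(restr (y + z)).
- rewrite -fsbig_split// !fsbig_finite//= ler_sum// => p _.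
  by rewrite -mulrDr ler_wpM2l ?enorm_ge0// ler_normD.
- move=> p /= yzp; have [yp0|yp0] := eqVneq (y p) 0; last by left; exact/eqP.
  by right=> zp0; apply: yzp; rewrite fctE yp0 zp0 addr0.
- by move=> p; right.
- by move=> p; left.
Qed.

Lemma star_normZ (a : R) y : star_norm (a *: y) = `|a| * star_norm y.
Proof.
rewrite /star_norm mulrDr; congr (_ + _); first by rewrite -normrM.
rewrite mulr_fsumr; apply: eq_fsbigr => p _.
by rewrite mulrCA -normrM.
Qed.

Lemma star_norm_eq0 y : star_norm y = 0 -> y = 0.
Proof.
have ge0 p : 0 <= enorm p * `|y p| by rewrite mulr_ge0 ?enorm_ge0.
move=> /eqP; rewrite /star_norm paddr_eq0 ?fsumr_ge0//.
move=> /andP[/eqP/normr0_eq0 y0 /eqP s0].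
apply/val_inj/funext => p; change (y p = 0).
have [->//|p0] := eqVneq p 0.
have [->//|yp0] := eqVneq (y p) 0.
have ep0 : enorm p * `|y p| <> 0.
  apply/eqP; rewrite mulf_neq0 ?normr_eq0//.
  by apply: contra p0 => /eqP/enorm_eq0/eqP.
rewrite fsbig_supp in s0.
by have := pfsumr_eq0 (star_norm_finite y _) (fun p _ => ge0 p) s0 (conj I ep0).
Qed.

HB.instance Definition _ :=
  Lmodule_isNormed.Build R finfct star_normD star_normZ star_norm_eq0.

Definition finfct_ge0 : set finfct := [set y | forall p, 0 <= y p].

End FiniteSupport.

Section Hulls.
Variables (R : realType) (E : lmodType R).
Implicit Types C : set E.

Definition conv_hull C : set E := smallest (@convex_set R E) C.

Definition aff_hull C : set E :=
  [set x | exists (k : nat) (c : 'I_k -> R) (v : 'I_k -> E),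
    [/\ forall i, C (v i), \sum_(i < k) c i = 1 &
        x = \sum_(i < k) c i *: v i]].

Definition minkowski_sum (A B : set E) : set E :=
  [set x + y | x in A & y in B].

End Hulls.

Section InfiniteModels.
Variables (R : realType) (n : nat) (b : 'rV[R]_n).
Local Notation V := 'rV[R]_n.

(* z \is a mxOver Num.int expresses z \in Z^n. *)
Definition M_ : set (finfct R n * finfct R n) :=
  [set sy : finfct R n * finfct R n |
             [/\ finfct_ge0 sy.1,
                forall p, sy.2 p \is a Num.nat &
                exists2 z : V, z \is a mxOver Num.int &
                  \sum_(r \in [set: V]) sy.1 r *: r +
                  \sum_(p \in [set: V]) sy.2 p *: p = b + z]].

Definition I_ : set (finfct R n) := [set y | M_ (0, y)].

Definition tuple_lhs (psi pi : V -> R) (s y : finfct R n) : R :=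
  \sum_(r \in [set: V]) psi r * s r + \sum_(p \in [set: V]) pi p * y p.

Definition valid_tuple (psi pi : V -> R) (alpha : R) : Prop :=
  alpha \in [:: -1; 0; 1] /\
  forall s y, M_ (s, y) -> alpha <= tuple_lhs psi pi s y.

Definition Q_ : set (finfct R n * finfct R n) :=
  [set sy : finfct R n * finfct R n | [/\ finfct_ge0 sy.1, finfct_ge0 sy.2 &
    forall psi pi alpha, valid_tuple psi pi alpha ->
      alpha <= tuple_lhs psi pi sy.1 sy.2]].

Definition G_ : set (finfct R n) := [set y | Q_ (0, y)].

End InfiniteModels.

(* Main.v *)
Require Import Defs.
From HB Require Import structures.
From mathcomp Require Import all_boot all_order all_algebra.
From mathcomp Require Import all_classical all_reals all_analysis.
From mathcomp Require Import ring lra.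

(* Write C for the convex hull of I_b and A for its affine hull. The sets C, G_b
   and cl(C) all lie between C and C + P, where P is the cone of nonnegative
   functions, so it suffices to show (C + P) `&` A `<=` C.
   - A nonnegative y outside C + P violates a valid tuple. Restricted to the
     support of y, the points of I_b are dominated by finitely many of them
     (Dickson), so a nonnegative weight separates y from I_b there. Raising the
     weight slightly makes it positive, and it then extends to a valid tuple
     whose continuous part is a large multiple of the Euclidean norm. Such
     tuples are continuous for the star norm, which also handles cl(C).
   - If y = x + r lies in A with x in C and r in P, then r is a real combination
     of integer-valued functions g with \sum g(p) p integral. By simultaneous
     Diophantine approximation r is even a nonnegative combination of
     nonnegative such g, and these are recession directions of C. *)

Set Implicit Arguments.
Unset Strict Implicit.
Unset Printing Implicit Defensive.

Import Order.TTheory GRing.Theory Num.Theory.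
Import numFieldNormedType.Exports.
Local Open Scope classical_set_scope.
Local Open Scope ring_scope.

(** * Dominance, Diophantine approximation and separation in finite dimension *)

Lemma dickson (X : Type) (T : eqType) (e : X -> T -> nat) (S : seq T)
    (A : set X) :
  exists F : set X, [/\ finite_set F, F `<=` A &
    forall x, A x -> exists2 f, F f & forall p, p \in S -> (e f p <= e x p)%N].
Proof.
elim: S A => [|p S IH] A.
  have [[x Ax]|A0] := pselect (A !=set0).
    exists [set x]; split=> [//|_ ->//|y _]; by exists x.
  by exists set0; split=> // x Ax; case: A0; exists x.
have [F [finF FA FP]] := IH A.
have [N FN] : exists N, forall f, F f -> (e f p <= N)%N.
  have /finite_seqP[s sE] := finite_image (e^~ p) finF.
  exists (\max_(i <- s) i)%N => f Ff.
  apply: (@leq_bigmax_seq _ _ xpredT id) => //.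
  suff : [set` s] (e f p) by [].
  by rewrite -sE; exists f.
have [G GP] := choice (fun j => IH (A `&` [set x | e x p = j])).
(* [F] dominates in all coordinates but [p], hence also in [p] once [e x p >= N]. The other points
   lie in the [N] slices [e x p = j], and [G j] dominates within its slice. *)
exists (F `|` \bigcup_(j in `I_N) G j); split.
- rewrite finite_setU; split=> //; apply: bigcup_finite => // j _.
  by have [] := GP j.
- move=> x [/FA//|[j _]]; have [_ GA _] := GP j.
  by move=> /GA[].
move=> x Ax; have [xN|Nx] := ltnP (e x p) N.
  have [_ GA /(_ x (conj Ax erefl))[f Gf fx]] := GP (e x p).
  exists f; first by right; exists (e x p).
  move=> q; rewrite inE => /predU1P[->|/fx//].
  by have [_ ->] := GA _ Gf.
have [f Ff fx] := FP x Ax; exists f; first by left.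
move=> q; rewrite inE => /predU1P[->|/fx//].
exact: leq_trans (FN f Ff) Nx.
Qed.

(** Pigeonhole: cut the unit cube into [M ^ k] boxes of side [1 / M < e]. Among [M ^ k + 1]
    multiples of [t], two have fractional parts in the same box, and their difference gives [N]. *)
Lemma dirichlet_approximation (R : realType) (k : nat) (t : 'I_k -> R) (e : R) :
  0 < e -> exists (N : nat) (m : 'I_k -> int),
    (0 < N)%N /\ forall i, `|N%:R * t i - (m i)%:~R| < e.
Proof.
move=> e0; pose M := (Num.truncn e^-1).+1.
have Me : (M%:R : R)^-1 < e.
  by rewrite invf_plt ?posrE ?ltr0n// truncnS_gt.
have M0 : 0 < (M%:R : R) by rewrite ltr0n.
pose frac (x : R) := x - (Num.floor x)%:~R.
have frac_itv x : 0 <= frac x < 1.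
  by have := floor_itv x; rewrite /frac intrD; lra.
have box_lt x : (Num.truncn (M%:R * frac x) < M)%N.
  have /andP[x0 x1] := frac_itv x.
  rewrite truncn_lt_nat; last by rewrite mulr_ge0// ltW.
  by rewrite -[ltRHS]mulr1 ltr_pM2l.
pose box (a : 'I_(#|{: {ffun 'I_k -> 'I_M}}|).+1) :=
  [ffun i => Ordinal (box_lt (a%:R * t i))].
have : ~~ injectiveb box.
  apply/negP => /injectiveP /leq_card; rewrite card_ord; by rewrite ltnn.
move=> /injectivePn[a [a' aa' boxaa']].
wlog ltaa' : a a' aa' boxaa' / (a < a')%N.
  move=> H; have [/H|/H|/val_inj/eqP] := ltngtP a a'; first exact.
    by apply; [rewrite eq_sym|].
  by rewrite (negPf aa').
exists (a' - a)%N, (fun i => Num.floor (a'%:R * t i) - Num.floor (a%:R * t i)).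
split=> [|i]; first by rewrite subn_gt0.
have := congr1 (fun g : {ffun _ -> _} => val (g i)) boxaa'.
rewrite !ffunE /= => boxE.
have /andP[fa _] := frac_itv (a%:R * t i).
have /andP[fa' _] := frac_itv (a'%:R * t i).
have := truncn_itv (mulr_ge0 (ltW M0) fa).
have := truncn_itv (mulr_ge0 (ltW M0) fa').
rewrite -boxE; move: (Num.truncn _) => q.
rewrite -natr1 => I1 I2.
apply: lt_trans Me.
rewrite natrB 1?ltnW// intrD intrN -(ltr_pM2l M0) mulfV ?gt_eqF//.
rewrite -[X in X * `|_|]gtr0_norm// -normrM.
move: I1 I2; rewrite /frac => I1 I2; rewrite ltr_norml.
by apply/andP; split; lra.
Qed.

(* The weight is the positive part of [c - y] at the point [c] of the convex hull
   minimising the sum of the squares of these positive parts. *)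
Lemma separation (R : realType) (m k : nat) (F : 'I_m -> 'I_k -> R)
    (y : 'I_k -> R) :
    (forall i p, 0 <= F i p) -> (forall p, 0 <= y p) ->
  (exists c : 'I_m -> R, [/\ forall i, 0 <= c i, \sum_i c i = 1 &
      forall p, \sum_i c i * F i p <= y p]) \/
  (exists w : 'I_k -> R, [/\ forall p, 0 <= w p, \sum_p w p * y p < 1 &
      forall i, 1 <= \sum_p w p * F i p]).
Proof.
case: m F => [|m] F F0 y0.
  right; exists (fun=> 0); split=> //; last by case.
  by rewrite big1// => p _; rewrite mul0r.
pose A := [set v : 'rV[R]_m.+1 | forall i, `[0, 1]%classic (v ord0 i)] `&`
          [set v : 'rV[R]_m.+1 | \sum_i v ord0 i = 1].
have sumC (h : 'I_m.+1 -> R) :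
    continuous (fun v : 'rV[R]_m.+1 => \sum_i v ord0 i * h i).
  apply: continuous_big => [|i _ v]; first exact: add_continuous.
  by apply: continuousM; [exact: coord_continuous|exact: cst_continuous].
have cA : compact A.
  apply: compact_closedI.
    exact: (@rV_compact R m.+1 (fun=> `[0, 1]%classic)
      (fun=> @segment_compact R 0 1)).
  rewrite (_ : mkset _ =
      (fun v : 'rV[R]_m.+1 => \sum_i v ord0 i * 1) @^-1` [set 1]).
    by apply: preimage_closed; [move=> ? _; exact: sumC|exact: closed_eq].
  by apply/funext => v /=; under [in RHS]eq_bigr do rewrite mulr1.
pose c (v : 'rV[R]_m.+1) p := \sum_i v ord0 i * F i p.
pose phi v := \sum_p Num.max (c v p - y p) 0 ^+ 2.
have phiC : continuous phi.
  apply: continuous_big => [|p _ v]; first exact: add_continuous.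
  apply: (@continuous_comp _ _ _ (fun v => Num.max (c v p - y p) 0)
    (fun x => x ^+ 2)); last exact: exprn_continuous.
  apply: continuous_max; last exact: cst_continuous.
  by apply: continuousB; [exact: sumC|exact: cst_continuous].
have delta_sum (i : 'I_m.+1) (h : 'I_m.+1 -> R) :
    \sum_j (j == i)%:R * h j = h i.
  rewrite (bigD1 i)//= eqxx mul1r big1 ?addr0// => j ji.
  by rewrite (negPf ji) mul0r.
have delta1 (i : 'I_m.+1) : \sum_j (j == i)%:R = 1 :> R.
  by rewrite -[RHS](delta_sum i (fun=> 1)); under [RHS]eq_bigr do rewrite mulr1.
have Aconv v i t : A v -> 0 <= t <= 1 ->
    A ((1 - t) *: v + t *: delta_mx ord0 i).
  move=> [v01 v1] t01; split=> [j|] /=.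
    have := v01 j; rewrite /= !in_itv/= !mxE => /andP[vj0 vj1].
    move: t01 => /andP[t0 t1].
    by rewrite eqxx; case: (_ == _) => /=; apply/andP; split; nra.
  under eq_bigr do rewrite !mxE.
  rewrite big_split/= -!mulr_sumr v1.
  by rewrite delta1 !mulr1 subrK.
have Adelta : A (delta_mx ord0 ord0).
  split=> [j|] /=.
    by rewrite !mxE in_itv/=; case: (_ == _); rewrite !lexx ler01.
  by under eq_bigr do rewrite mxE; rewrite delta1.
have [v /[!inE] Av vmin] : exists2 v, v \in A &
    forall u, u \in A -> phi v <= phi u.
  apply: EVT_min_rV => //; first by exists (delta_mx ord0 ord0).
  exact: continuous_subspaceT.
pose w p := Num.max (c v p - y p) 0.
have w0 p : 0 <= w p by rewrite le_max lexx orbT.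
have [v01 v1] := Av.
have [pw0|] := pselect (forall p, w p = 0).
  left; exists (v ord0); split=> // [i|p].
    by have := v01 i; rewrite /= in_itv/= => /andP[].
  by have := pw0 p; rewrite /w => /max_idPr; rewrite subr_le0.
move=> /existsNP[p0 /eqP wp0].
have ww : 0 < \sum_p w p ^+ 2.
  rewrite (bigD1 p0)//= ltr_pwDl ?sumr_ge0// => [|p _]; last exact: sqr_ge0.
  by rewrite exprn_gt0// lt_def wp0 w0.
have wcE : \sum_p w p * c v p = \sum_p w p * y p + \sum_p w p ^+ 2.
  rewrite -big_split/=; apply: eq_bigr => p _.
  by rewrite /w /Num.max; case: ltP; nra.
have c0 p : 0 <= c v p.
  apply: sumr_ge0 => i _; rewrite mulr_ge0//.
  by have := v01 i; rewrite /= in_itv/= => /andP[].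
have wy0 : 0 <= \sum_p w p * y p by apply: sumr_ge0 => p _; rewrite mulr_ge0.
(* First-order optimality of [v]: if the slope [g] towards vertex [i] were negative, a short move in
   that direction would decrease [phi]. *)
have wF i : \sum_p w p * c v p <= \sum_p w p * F i p.
  rewrite -subr_ge0 -sumrB leNgt; apply/negP; set g := (X in X < 0) => g0.
  pose D := \sum_p (F i p - c v p) ^+ 2.
  have D0 : 0 <= D by apply: sumr_ge0 => p _; exact: sqr_ge0.
  (* This step length satisfies [t <= 1] and [t * D < - g], so the change [2 * t * g + t ^+ 2 * D]
     is below [t * g < 0]. *)
  have [t t0 tE] : exists2 t, 0 < t & t * (D - g) = - g.
    exists (- g / (D - g)); first by rewrite divr_gt0; lra.
    by rewrite mulfVK//; lra.
  have t01 : 0 <= t <= 1 by apply/andP; split; nra.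
  have := vmin _ (mem_set (Aconv v i t Av t01)); apply/negP; rewrite -ltNge.
  have cE p : c ((1 - t) *: v + t *: delta_mx ord0 i) p =
      c v p + t * (F i p - c v p).
    rewrite /c; under eq_bigr do rewrite !mxE mulrDl -!mulrA.
    rewrite big_split/= -!mulr_sumr.
    by rewrite (delta_sum i (F^~ p)); lra.
  (* Moving the argument of a positive part by [u] gives a value whose square is at most that of the
     old positive part plus [u], which leaves a polynomial in [t]. *)
  apply: (@le_lt_trans _ _ (\sum_p (w p + t * (F i p - c v p)) ^+ 2)).
    apply: ler_sum => p _; rewrite cE /w; set u := t * _.
    rewrite addrAC /Num.max; case: ltP => ?; case: ltP => ?; nra.
  have -> : \sum_p (w p + t * (F i p - c v p)) ^+ 2 =
      phi v + 2 * t * g + t ^+ 2 * D.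
    rewrite /phi /g /D !mulr_sumr -!big_split/=; apply: eq_bigr => p _.
    by rewrite -/(w p); ring.
  have : t * D < - g by nra.
  by nra.
(* Normalised so that the minimiser [c v] has weight 1; by [wcE] the point [y] falls short of it by
   a positive amount. *)
right; exists (fun p => w p / \sum_p w p * c v p).
have wc0 : 0 < \sum_p w p * c v p by rewrite wcE; lra.
split=> [p||i]; first by rewrite divr_ge0// ltW.
- under eq_bigr do rewrite mulrAC.
  by rewrite -mulr_suml ltr_pdivrMr// wcE; lra.
- under eq_bigr do rewrite mulrAC.
  by rewrite -mulr_suml ler_pdivlMr// mul1r.
Qed.

(** * Finitely supported functions and their pairings *)

Section FiniteSums.
Variables (R : realType) (n : nat).
Local Notation V := 'rV[R]_n.
Implicit Types u v : finfct R n.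

Definition supp u : seq V :=
  finmap.enum_fset (fset_set ((u : V -> R) @^-1` [set~ 0])).

Lemma supp_uniq u : uniq (supp u).
Proof. exact: finmap.fset_uniq. Qed.

Lemma mem_supp u p : (p \in supp u) = (u p != 0).
Proof.
rewrite /supp in_fset_set; last exact: finfct_finite.
by apply/idP/idP => [/set_mem/eqP|up]; last exact/mem_set/eqP.
Qed.

Lemma fsum_suppE (W : zmodType) (h : V -> R -> W) u (S : seq V) :
    (forall p, h p 0 = 0) -> uniq S -> {subset supp u <= S} ->
  \sum_(p \in [set: V]) h p (u p) = \sum_(p <- S) h p (u p).
Proof.
move=> h0 uniqS subS; rewrite [RHS]fsbig_seq//.
apply/esym/fsbig_widen => // p [_ /= /negP pS].
by have := contra (subS p) pS; rewrite mem_supp negbK => /eqP ->.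
Qed.

Definition lsum (W : lmodType R) (f : V -> W) u : W :=
  \sum_(p \in [set: V]) u p *: f p.

Lemma lsumE (W : lmodType R) (f : V -> W) u (S : seq V) :
  uniq S -> {subset supp u <= S} -> lsum f u = \sum_(p <- S) u p *: f p.
Proof.
by apply: (@fsum_suppE W (fun p a => a *: f p)) => p; rewrite scale0r.
Qed.

Lemma lsum_is_linear (W : lmodType R) (f : V -> W) : linear (lsum f).
Proof.
move=> a u v; pose S := undup (supp u ++ supp v ++ supp (a *: u + v)).
have SE (w : finfct R n) :
    {subset supp w <= supp u ++ supp v ++ supp (a *: u + v)} ->
    lsum f w = \sum_(p <- S) w p *: f p.
  move=> sub; apply: lsumE; first exact: undup_uniq.
  by move=> p /sub; rewrite mem_undup.
rewrite !SE => [|p pS|p pS|p pS]; rewrite ?mem_cat ?pS ?orbT//.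
rewrite scaler_sumr -big_split; apply: eq_bigr => p _ /=.
by rewrite scalerA -scalerDl.
Qed.

HB.instance Definition _ (W : lmodType R) (f : V -> W) :=
  GRing.isLinear.Build R (finfct R n) W _ (lsum f) (lsum_is_linear f).

Lemma finfctDE u v p : (u + v) p = u p + v p. Proof. by []. Qed.
Lemma finfctNE u p : (- u) p = - u p. Proof. by []. Qed.
Lemma finfctZE a u p : (a *: u) p = a * u p. Proof. by []. Qed.

Lemma finfct_sumE (I : Type) (r : seq I) (P : pred I) (F : I -> finfct R n) p :
  (\sum_(i <- r | P i) F i) p = \sum_(i <- r | P i) F i p.
Proof. exact: (big_morph (fun u : finfct R n => u p)). Qed.

Lemma finfctP u v : (forall p, u p = v p) -> u = v.
Proof. by move=> uv; apply/val_inj/funext. Qed.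

Lemma finrestr_finsupp (D : pred V) u :
  (fun p => if D p then u p else 0) \in @finsupp R n.
Proof.
apply/asboolP; apply: sub_finite_set (finfct_finite u) => p /=.
by case: ifP.
Qed.

Definition finrestr (D : pred V) u : finfct R n :=
  FinFct (finrestr_finsupp D u).

Lemma finrestrE D u p : finrestr D u p = if D p then u p else 0.
Proof. by []. Qed.

Lemma finrestrDC D u : finrestr (predC D) u + finrestr D u = u.
Proof.
apply: finfctP => p; rewrite finfctDE !finrestrE /=.
by case: (D p); rewrite ?addr0 ?add0r.
Qed.

Definition dot (f : V -> R) u : R := \sum_(p \in [set: V]) f p * u p.

Lemma dotE f u (S : seq V) :
  uniq S -> {subset supp u <= S} -> dot f u = \sum_(p <- S) f p * u p.
Proof. by apply: (@fsum_suppE R (fun p a => f p * a)) => p; rewrite mulr0. Qed.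

Lemma dot_lsum f u : dot f u = lsum (f : V -> R^o) u.
Proof. by apply: eq_fsbigr => p _; rewrite mulrC. Qed.

Lemma dot_is_scalar f : scalar (dot f).
Proof. by move=> a u v; rewrite !dot_lsum linearP. Qed.

HB.instance Definition _ f :=
  GRing.isLinear.Build R (finfct R n) R _ (dot f) (dot_is_scalar f).

Lemma dot_finrestr f D u :
  dot f (finrestr D u) = dot (fun p => if D p then f p else 0) u.
Proof.
apply: eq_fsbigr => p _.
by rewrite finrestrE; case: ifP; rewrite ?mulr0 ?mul0r.
Qed.

Lemma tuple_lhsE (psi pi : V -> R) u v :
  tuple_lhs psi pi u v = dot psi u + dot pi v.
Proof. by []. Qed.

End FiniteSums.

(** * Convex and affine hulls *)

Section Hulls.
Variables (R : realType) (E : lmodType R).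
Implicit Types (A D : set E) (x y : E).

Lemma conv_hull_sub A D :
    (forall x y t, 0 <= t -> t <= 1 -> D x -> D y ->
      D (t *: x + (1 - t) *: y)) ->
  A `<=` D -> conv_hull A `<=` D.
Proof.
move=> convD AD; apply: smallest_sub => // x y l /[!inE] Dx Dy.
exact: convD.
Qed.

Lemma sub_conv_hull A : A `<=` conv_hull A.
Proof. exact: sub_smallest. Qed.

Lemma conv_hull_conv A x y t : 0 <= t -> t <= 1 ->
  conv_hull A x -> conv_hull A y -> conv_hull A (t *: x + (1 - t) *: y).
Proof.
move=> t0 t1 Ax Ay D [convD AD].
have := convD x y (Itv01 t0 t1); rewrite !inE; apply; [exact: Ax|exact: Ay].
Qed.

Lemma conv_hull_sum A (m : nat) (c : 'I_m -> R) (x : 'I_m -> E) :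
    (forall i, 0 <= c i) -> \sum_i c i = 1 -> (forall i, conv_hull A (x i)) ->
  conv_hull A (\sum_i c i *: x i).
Proof.
elim: m c x => [|m IH] c x c0.
  by rewrite big_ord0 => /eqP; rewrite eq_sym oner_eq0.
rewrite !big_ord_recl => c1 Ax.
have s0 : 0 <= \sum_(i < m) c (lift ord0 i) by exact: sumr_ge0.
have c0E : c ord0 = 1 - \sum_(i < m) c (lift ord0 i) by lra.
have [s00|sN0] := eqVneq (\sum_(i < m) c (lift ord0 i)) 0.
  rewrite c0E s00 subr0 scale1r big1 ?addr0// => i _.
  move/eqP: s00; rewrite psumr_eq0// => /allP/(_ i (mem_index_enum _))/eqP ->.
  by rewrite scale0r.
set s := \sum_(i < m) _ in s0 c0E sN0.
have -> : \sum_(i < m) c (lift ord0 i) *: x (lift ord0 i) =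
    (1 - c ord0) *: \sum_(i < m) (c (lift ord0 i) / s) *: x (lift ord0 i).
  rewrite scaler_sumr; apply: eq_bigr => i _.
  by rewrite c0E subKr scalerA mulrC divfK.
have c01 := c0 ord0.
apply: conv_hull_conv => //; first by lra.
apply: IH => //; first by move=> i; rewrite divr_ge0.
by rewrite -mulr_suml divff.
Qed.

Lemma aff_hull_conv A x y t :
  aff_hull A x -> aff_hull A y -> aff_hull A (t *: x + (1 - t) *: y).
Proof.
move=> [k [c [v [Av c1 ->]]]] [k' [c' [v' [Av' c'1 ->]]]].
exists (k + k')%N,
  (fun i => match fintype.split i with
            | inl j => t * c j | inr j => (1 - t) * c' j end),
  (fun i => match fintype.split i with inl j => v j | inr j => v' j end).
split=> [i||]; first by case: fintype.split.
- rewrite big_split_ord/=.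
  under eq_bigr do rewrite (unsplitK (inl _)).
  under [X in _ + X]eq_bigr do rewrite (unsplitK (inr _)).
  by rewrite -!mulr_sumr c1 c'1; lra.
- rewrite big_split_ord/= !scaler_sumr; congr (_ + _); apply: eq_bigr => i _.
    by rewrite (unsplitK (inl _)) scalerA.
  by rewrite (unsplitK (inr _)) scalerA.
Qed.

Lemma sub_aff_hull A : A `<=` aff_hull A.
Proof.
move=> x Ax; exists 1%N, (fun=> 1), (fun=> x).
by split=> //; rewrite big_ord1// scale1r.
Qed.

Lemma conv_hull_sub_aff_hull A : conv_hull A `<=` aff_hull A.
Proof.
apply: conv_hull_sub; last exact: sub_aff_hull.
by move=> x y t _ _; exact: aff_hull_conv.
Qed.

(** Every point of either combination is measured from the common base point [v ord0]. Both families
    of coefficients sum to 1, so the base terms cancel in [x - y]. *)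
Lemma aff_hullB A x y : aff_hull A x -> aff_hull A y ->
  exists (k : nat) (t : 'I_k -> R) (g : 'I_k -> E),
    (forall i, exists a b, [/\ A a, A b & g i = a - b]) /\
    x - y = \sum_i t i *: g i.
Proof.
move=> [[|k] [c [v [Av c1 ->]]]] [k' [c' [v' [Av' c'1 ->]]]].
  by move/eqP: c1; rewrite big_ord0 eq_sym oner_eq0.
exists (k.+1 + k')%N,
  (fun i => match fintype.split i with inl j => c j | inr j => - c' j end),
  (fun i => match fintype.split i with
            | inl j => v j - v ord0 | inr j => v' j - v ord0 end).
split=> [i|].
  by case: fintype.split => j; [exists (v j), (v ord0)|exists (v' j), (v ord0)].
rewrite big_split_ord/=.
rewrite [X in _ = X + _](eq_bigr (fun j => c j *: v j - c j *: v ord0));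
  last by move=> j _; rewrite (unsplitK (inl j)) scalerBr.
rewrite [X in _ = _ + X](eq_bigr (fun j => - (c' j *: v' j) + c' j *: v ord0));
  last by move=> j _; rewrite (unsplitK (inr j)) scaleNr scalerBr opprB addrC.
rewrite !big_split/= !sumrN -!scaler_suml c1 c'1 !scale1r.
by rewrite addrACA addNr addr0.
Qed.

End Hulls.

(** * Recession directions of the convex hull *)

Section Lattice.
Variables (R : realType) (n : nat) (b : 'rV[R]_n).
Local Notation V := 'rV[R]_n.
Implicit Types (g u x y : finfct R n).

Lemma mxOver_intB (v w : V) : v \is a mxOver Num.int ->
  w \is a mxOver Num.int -> v - w \is a mxOver Num.int.
Proof.
move=> /mxOverP vint /mxOverP wint; apply/mxOverP => i j.
by rewrite !mxE rpredB.
Qed.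

Lemma mxOver_intD (v w : V) : v \is a mxOver Num.int ->
  w \is a mxOver Num.int -> v + w \is a mxOver Num.int.
Proof.
move=> /mxOverP vint /mxOverP wint; apply/mxOverP => i j.
by rewrite !mxE rpredD.
Qed.

Lemma mxOver_intZ (a : R) (v : V) : a \is a Num.int ->
  v \is a mxOver Num.int -> a *: v \is a mxOver Num.int.
Proof.
by move=> aint /mxOverP vint; apply/mxOverP => i j; rewrite mxE rpredM.
Qed.

Lemma I_P y : I_ b y <->
  (forall p, y p \is a Num.nat) /\ lsum id y - b \is a mxOver Num.int.
Proof.
have E : lsum id (0 : finfct R n) + lsum id y = lsum id y.
  by rewrite linear0 add0r.
split=> [[_ /= ynat [z zint yE]]|[ynat yint]].
  split=> //; rewrite -E [X in X - _]yE addrC addKr//.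
split=> //=; exists (lsum id y - b) => //.
by rewrite [LHS]E addrC subrK.
Qed.

(** The group containing all differences of points of [I_ b]; adding a nonnegative element keeps a
    point in [I_ b]. *)
Definition relation_lattice : set (finfct R n) :=
  [set g : finfct R n |
    (forall p, g p \is a Num.int) /\ lsum id g \is a mxOver Num.int].

Lemma relation_latticeB x y : I_ b x -> I_ b y -> relation_lattice (x - y).
Proof.
move=> /I_P[xnat xint] /I_P[ynat yint]; split=> [p|].
  by rewrite finfctDE finfctNE rpredB// intr_nat.
have -> : lsum id (x - y) = (lsum id x - b) - (lsum id y - b).
  by rewrite linearB opprB addrA subrK.
exact: mxOver_intB.
Qed.

Lemma relation_lattice_sum (k : nat) (m : 'I_k -> int)
    (g : 'I_k -> finfct R n) :
  (forall i, relation_lattice (g i)) ->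
  relation_lattice (\sum_i (m i)%:~R *: g i).
Proof.
move=> latg; split=> [p|].
  rewrite finfct_sumE rpred_sum// => i _.
  by rewrite finfctZE rpredM// ?intr_int//; have [] := latg i.
rewrite linear_sum; apply: (big_ind (fun v => v \is a mxOver _)) => [|v w|i _].
- by apply/mxOverP => i j; rewrite mxE.
- exact: mxOver_intD.
- by rewrite linearZ mxOver_intZ// ?intr_int//; have [] := latg i.
Qed.

Lemma I_shift x g (N : nat) : I_ b x -> relation_lattice g -> finfct_ge0 g ->
  I_ b (x + N%:R *: g).
Proof.
move=> /I_P[xnat xint] [gint gsum] g0; apply/I_P; split=> [p|].
  have gnat : g p \is a Num.nat by rewrite natrEint gint g0.
  by rewrite finfctDE finfctZE rpredD ?rpredM ?natr_nat.
by rewrite linearD linearZ addrAC mxOver_intD// mxOver_intZ.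
Qed.

(** For [x] in [I_ b] and an integer [N > t], the point [x + t *: g] lies on the segment from [x] to
    [x + N%:R *: g], whose ends are in [I_ b]. The property is preserved by convex combinations of
    [x]. *)
Lemma conv_hull_ray x g (t : R) : conv_hull (I_ b) x -> relation_lattice g ->
  finfct_ge0 g -> 0 <= t -> conv_hull (I_ b) (x + t *: g).
Proof.
move=> Cx latg g0 t0.
suff : conv_hull (I_ b) `<=` [set x | conv_hull (I_ b) (x + t *: g)] by exact.
apply: conv_hull_sub => {x Cx} [x y c c0 c1 Cx Cy|x Ix] /=.
  have -> : c *: x + (1 - c) *: y + t *: g =
      c *: (x + t *: g) + (1 - c) *: (y + t *: g).
    rewrite !scalerDr addrACA -scalerDl; congr (_ + _).
    by rewrite [c + _]addrC subrK scale1r.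
  exact: conv_hull_conv.
pose N := (Num.truncn t).+1; have tN : t < N%:R by exact: truncnS_gt.
have N0 : (N%:R : R) != 0 by rewrite pnatr_eq0.
have -> : x + t *: g = (t / N%:R) *: (x + N%:R *: g) + (1 - t / N%:R) *: x.
  rewrite scalerDr scalerA divfK// addrAC -scalerDl.
  by rewrite [_ / _ + _]addrC subrK scale1r.
apply: conv_hull_conv.
- by rewrite divr_ge0.
- by rewrite ler_pdivrMr ?mul1r ?ltr0n// ltW.
- by apply: sub_conv_hull; exact: I_shift.
- exact: sub_conv_hull.
Qed.

Lemma finfct_bounded u : exists M, forall p, `|u p| <= M.
Proof.
exists (\sum_(p <- supp u) `|u p|) => p.
have [->|up] := eqVneq (u p) 0; first by rewrite normr0 sumr_ge0.
by rewrite (big_rem p) ?mem_supp//= lerDl sumr_ge0.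
Qed.

(* Approximate a large multiple of [t] by integers [m]. The values of the
   combination [d] are integers at distance less than 1 from those of the
   multiple of [u], so [d] vanishes with [u] and is nonnegative. *)
Lemma relation_lattice_approx u (k : nat) (t : 'I_k -> R)
    (g : 'I_k -> finfct R n) :
    (forall i, relation_lattice (g i)) -> u = \sum_i t i *: g i ->
    finfct_ge0 u -> u != 0 ->
  exists m : 'I_k -> int, let d := \sum_i (m i)%:~R *: g i in
    [/\ finfct_ge0 d, forall p, u p = 0 -> d p = 0 & exists p, 0 < d p].
Proof.
move=> latg uE u0 uN0.
have [q uq] : exists q, 0 < u q.
  apply: contrapT => /forallNP H; move/eqP: uN0; apply; apply: finfctP => p.
  by apply/eqP; move/negP: (H p); rewrite lt_def u0 andbT negbK.
(* Scaling by [N0] lifts the value at [q] above 1, so it stays positive after an error less than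
   1. *)
pose N0 := (Num.truncn (u q)^-1).+1.
have N0q : 1 < N0%:R * u q.
  by rewrite -ltr_pdivrMr// mul1r truncnS_gt.
have [M MP] := choice (fun i => finfct_bounded (g i)).
have M0 i : 0 <= M i by apply: le_trans (MP i 0).
(* With precision [B^-1] for each coefficient, the total error is at most [(\sum_i M i) / B < 1] at
   every point. *)
pose B := 1 + \sum_i M i.
have B0 : 0 < B by rewrite ltr_pwDl// sumr_ge0.
have [N [m [Npos mP]]] :=
  @dirichlet_approximation R k (fun i => N0%:R * t i) B^-1
  ltac:(by rewrite invr_gt0).
exists m => d.
have [dint _] : relation_lattice d by exact: relation_lattice_sum.
have dP p : `|N%:R * N0%:R * u p - d p| < 1.
  rewrite uE !finfct_sumE mulr_sumr -sumrB.
  apply: le_lt_trans (ler_norm_sum _ _ _) _.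
  apply: (@le_lt_trans _ _ (\sum_i B^-1 * M i)).
    apply: ler_sum => i _; rewrite !finfctZE mulrA -mulrBl normrM.
    by rewrite ler_pM// -mulrA ltW.
  by rewrite -mulr_sumr mulrC ltr_pdivrMr// mul1r ltrDr.
have ud p : u p = 0 -> d p = 0.
  move=> up; apply/eqP/negPn/negP => dp; have := norm_intr_ge1 (dint p) dp.
  by have := dP p; rewrite up mulr0 sub0r normrN ltNge => /negP.
split=> // [p|].
  have /intrP[z zE] := dint p.
  have := dP p; rewrite zE ltr_norml => /andP[_].
  have : 0 <= N%:R * N0%:R * u p by rewrite !mulr_ge0.
  move=> ? ?; have : (-1)%:~R < z%:~R :> R by rewrite intrN; lra.
  by rewrite ltr_int ler0z; case: (z).
exists q; have := dP q; rewrite ltr_norml => /andP[_].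
have : (1:R) <= N%:R by rewrite ler1n.
nra.
Qed.

(** Induction on the size of the support of [u]: subtracting a suitable multiple of the
    approximating lattice element [d] keeps [u] nonnegative and removes a support point, and the
    subtracted part is a ray direction of the hull. *)
Lemma conv_hull_lattice_cone (k : nat) (g : 'I_k -> finfct R n)
    (t : 'I_k -> R) x :
    (forall i, relation_lattice (g i)) -> finfct_ge0 (\sum_i t i *: g i) ->
  conv_hull (I_ b) x -> conv_hull (I_ b) (x + \sum_i t i *: g i).
Proof.
move=> latg; move E : (\sum_i _) => u.
have [N leN] : exists N, (size (supp u) <= N)%N by exists (size (supp u)).
elim: N => [|N IH] in t u E leN x *; move=> u0 Cx.
  suff -> : u = 0 by rewrite addr0.
  apply: finfctP => p; apply/eqP; rewrite -[_ == _]negbK -mem_supp.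
  by move: leN; rewrite leqn0 size_eq0 => /eqP ->.
have [->|uN0] := eqVneq u 0; first by rewrite addr0.
have [m] := relation_lattice_approx latg (esym E) u0 uN0.
set d := \sum_i _ => /= -[d0 ud [q dq]].
have suppd p : p \in supp d -> 0 < d p /\ p \in supp u.
  rewrite !mem_supp => dp; split; first by rewrite lt_def dp d0.
  by apply: contra dp => /eqP/ud ->.
(* Ratio test: the smallest [u p / d p] is the largest multiple of [d] that can be subtracted from
   [u], and it makes [u] vanish at [p]. *)
have [p [pd pmin]] : exists p, p \in supp d /\
    forall p', p' \in supp d -> u p / d p <= u p' / d p'.
  have : supp d != [::].
    apply/eqP => sd; have : q \in supp d by rewrite mem_supp gt_eqF.
    by rewrite sd.
  elim: (supp d) => // a [|a' s] IHs _.
    by exists a; rewrite mem_head; split=> // p'; rewrite inE => /eqP ->.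
  have [p [pin pmin]] := IHs isT.
  have [ap|pa] := leP (u a / d a) (u p / d p).
    exists a; rewrite mem_head; split=> // p'.
    rewrite inE => /predU1P[->//|/pmin].
    exact: le_trans.
  exists p; rewrite inE pin orbT; split=> // p'.
  rewrite inE => /predU1P[->|/pmin//].
  exact: ltW.
pose c := u p / d p.
have [dp pu] := suppd p pd.
have c0 : 0 <= c by rewrite divr_ge0.
have -> : x + u = x + c *: d + (u - c *: d).
  by rewrite -addrA [c *: d + _]addrC subrK.
apply: (IH (fun i => t i - c * (m i)%:~R)).
- rewrite -E /d scaler_sumr -sumrB; apply: eq_bigr => i _.
  by rewrite scalerBl scalerA.
- rewrite -ltnS; apply: leq_trans leN.
  have: {subset supp (u - c *: d) <= rem p (supp u)}.
    move=> p'; rewrite mem_supp (mem_rem_uniq _ (supp_uniq u)) inE mem_supp.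
    apply: contraR; rewrite negb_and !negbK finfctDE finfctNE finfctZE.
    move=> /orP[/eqP ->|/eqP up']; first by rewrite /c divfK ?subrr// gt_eqF.
    by rewrite up' ud// mulr0 subrr.
  move=> /(uniq_leq_size (supp_uniq _)); rewrite size_rem// => /leq_ltn_trans.
  apply; rewrite ltn_predL; by case: (supp u) pu.
- move=> p'; rewrite finfctDE finfctNE finfctZE subr_ge0.
  have [dp'|dp'] := eqVneq (d p') 0; first by rewrite dp' mulr0.
  have p'd : p' \in supp d by rewrite mem_supp.
  by rewrite -ler_pdivlMr ?pmin//; have [] := suppd _ p'd.
- by apply: conv_hull_ray => //; exact: relation_lattice_sum.
Qed.

(** Both [x + r] and [x] are in the affine hull, so [r] is a real combination of differences of
    points of [I_ b], that is, of lattice elements. *)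
Lemma minkowski_sum_aff_hull_sub :
  minkowski_sum (conv_hull (I_ b)) (@finfct_ge0 R n) `&` aff_hull (I_ b)
    `<=` conv_hull (I_ b).
Proof.
move=> _ [[x Cx [r r0 <-]] Axr].
have [k [t [g [gP]]]] := aff_hullB Axr (conv_hull_sub_aff_hull Cx).
rewrite addrC addKr => rE; rewrite rE; apply: conv_hull_lattice_cone => //.
  by move=> i; have [y [z [Iy Iz ->]]] := gP i; exact: relation_latticeB.
by rewrite -rE.
Qed.

End Lattice.

(** * Distance to the integers and estimates in the star norm *)

Lemma int_translate_bounded (R : realType) (a : R) : a \isn't a Num.int ->
  exists2 L, 0 <= L & forall z, z \is a Num.int -> 1 <= L * `|a + z|.
Proof.
move=> aint; have /andP[fa_le fa_lt] := floor_itv a.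
set c := (Num.floor a)%:~R in fa_le *.
have ca : c < a.
  rewrite lt_neqAle fa_le andbT; apply: contra aint => /eqP <-.
  exact: intr_int.
have ac : a < c + 1 by move: fa_lt; rewrite intrD.
(* Any integer translate of [a] has absolute value at least one of the two gaps [a - c] and
   [c + 1 - a]; the sum of the inverses serves both cases. *)
exists ((a - c)^-1 + (c + 1 - a)^-1).
  by rewrite addr_ge0// invr_ge0 subr_ge0 ltW.
move=> _ /intrP[z ->].
have f1 : 0 < (a - c)^-1 by rewrite invr_gt0 subr_gt0.
have f2 : 0 < (c + 1 - a)^-1 by rewrite invr_gt0 subr_gt0.
have e1 : (a - c)^-1 * (a - c) = 1 by rewrite mulVf// subr_eq0 gt_eqF.
have e2 : (c + 1 - a)^-1 * (c + 1 - a) = 1.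
  by rewrite mulVf// subr_eq0 gt_eqF.
have : a - c <= `|a + z%:~R| \/ c + 1 - a <= `|a + z%:~R|.
  have [cz|cz] := lerP 0 (Num.floor a + z); [left|right].
    have := ler_norm (a + z%:~R).
    by move: cz; rewrite -(ler_int R) intrD -/c; lra.
  have := ler_norm (- (a + z%:~R)); rewrite normrN.
  by move: cz; rewrite -lezD1 -(ler_int R) !intrD -/c; lra.
have := normr_ge0 (a + z%:~R).
move: f1 f2 e1 e2 => f1 f2 e1 e2 n0 [] ?; nra.
Qed.

Section Separation.
Variables (R : realType) (n : nat).
Local Notation V := 'rV[R]_n.
Implicit Types (u x y : finfct R n) (f g : V -> R).

Lemma ler_norm_enorm (p : V) i : `|p ord0 i| <= enorm p.
Proof.
rewrite -sqrtr_sqr ler_wsqrtr// (bigD1 i)//= lerDl.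
by apply: sumr_ge0 => j _; exact: sqr_ge0.
Qed.

Lemma ler_norm_lsum u i : finfct_ge0 u ->
  `|(lsum id u : V) ord0 i| <= dot (@enorm R n) u.
Proof.
move=> u0; rewrite (lsumE _ (supp_uniq u) (fun _ => id)) summxE.
rewrite (dotE _ (supp_uniq u) (fun _ => id)).
apply: le_trans (ler_norm_sum _ _ _) _; apply: ler_sum => p _.
rewrite mxE normrM mulrC (ger0_norm (u0 p)).
by rewrite ler_wpM2r ?ler_norm_enorm//; exact: u0.
Qed.

Lemma dot_ge0 f u : (forall p, 0 <= f p) -> finfct_ge0 u -> 0 <= dot f u.
Proof.
move=> f0 u0; rewrite (dotE _ (supp_uniq u) (fun _ => id)).
by apply: sumr_ge0 => p _; rewrite mulr_ge0// ?f0; exact: u0.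
Qed.

Lemma ler_dot_term f u p : (forall p, 0 <= f p) -> finfct_ge0 u ->
  f p * u p <= dot f u.
Proof.
move=> f0 u0; rewrite (dotE _ (supp_uniq u) (fun _ => id)).
have S0 (s : seq V) : 0 <= \sum_(q <- s) f q * u q.
  by apply: sumr_ge0 => q _; rewrite mulr_ge0// ?f0; exact: u0.
have [->|up] := eqVneq (u p) 0; first by rewrite mulr0.
by rewrite (big_rem p) ?mem_supp//= lerDl.
Qed.

Lemma dot_pred1 p u : dot (fun q => (q == p)%:R) u = u p.
Proof.
rewrite (@dotE _ _ _ _ (undup (p :: supp u))) ?undup_uniq//; last first.
  by move=> q qu; rewrite mem_undup inE qu orbT.
rewrite (bigD1_seq p) ?undup_uniq ?mem_undup ?mem_head//= eqxx mul1r.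
by rewrite big1 ?addr0// => q /negPf ->; rewrite mul0r.
Qed.

(** The star norm is a weighted l1 norm with weight [enorm p + (p == 0)%:R] at [p], so a function
    bounded by this weight pairs continuously. *)
Lemma ler_norm_dot f K u :
    (forall p, `|f p| <= K * (enorm p + (p == 0)%:R)) ->
  `|dot f u| <= K * star_norm u.
Proof.
move=> fK; pose S := undup (0 :: supp u).
have uS : uniq S by exact: undup_uniq.
have sub : {subset supp u <= S}.
  by move=> q qu; rewrite mem_undup inE qu orbT.
have -> : star_norm u = \sum_(p <- S) (enorm p + (p == 0)%:R) * `|u p|.
  rewrite /star_norm (@fsum_suppE _ _ _ (fun p a => enorm p * `|a|) u S)//;
    last by move=> p; rewrite normr0 mulr0.
  rewrite addrC; under [RHS]eq_bigr do rewrite mulrDl.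
  rewrite big_split/=; congr (_ + _).
  rewrite [RHS](bigD1_seq 0) ?mem_undup ?mem_head//= eqxx mul1r.
  by rewrite big1 ?addr0// => q /negPf ->; rewrite mul0r.
rewrite (dotE f uS sub) mulr_sumr; apply: le_trans (ler_norm_sum _ _ _) _.
by apply: ler_sum => p _; rewrite normrM mulrA ler_wpM2r.
Qed.

(** The weight is positive everywhere, including at 0, so the finitely many values on [S] are
    absorbed by enlarging [K]. *)
Lemma enorm_bound f (S : seq V) (L : R) :
    (forall p, p \notin S -> f p = L * enorm p) ->
  exists K, forall p, `|f p| <= K * (enorm p + (p == 0)%:R).
Proof.
move=> fS; pose w (p : V) := enorm p + (p == 0)%:R.
have w0 p : 0 < w p.
  rewrite /w; have [_|p0] := eqVneq p 0.
    by rewrite ltr_wpDl ?enorm_ge0.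
  rewrite addr0 lt_def enorm_ge0 andbT.
  by apply: contra p0 => /eqP/enorm_eq0 ->.
have T0 (s : seq V) : 0 <= \sum_(p <- s) `|f p| / w p.
  by apply: sumr_ge0 => p _; rewrite divr_ge0// ltW.
exists (`|L| + \sum_(p <- S) `|f p| / w p) => p; rewrite -/(w p).
have [pS|pS] := boolP (p \in S).
  rewrite -ler_pdivrMr// (big_rem p)//= addrCA lerDl.
  by rewrite addr_ge0.
rewrite (fS p pS) normrM ler_pM// ?lerDl//.
by rewrite ger0_norm ?enorm_ge0// lerDl ler0n.
Qed.

Lemma closure_dot_ge (A : set (finfct R n)) f K a :
    (forall p, `|f p| <= K * (enorm p + (p == 0)%:R)) ->
    (forall x, A x -> a <= dot f x) ->
  forall y, closure A y -> a <= dot f y.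
Proof.
move=> fK fA y clAy; rewrite leNgt; apply/negP => fya.
have K0 : 0 <= K.
  have := fK 0; rewrite eqxx mulr1n; have := enorm_ge0 (0 : V).
  have := normr_ge0 (f 0); nra.
(* A point within [e] of [y] changes the pairing by at most [K * e], less than the gap; [K + 1] also
   covers [K = 0]. *)
pose e := (a - dot f y) / (K + 1).
have eE : e * (K + 1) = a - dot f y by rewrite /e mulfVK//; lra.
have e0 : 0 < e by rewrite divr_gt0 ?subr_gt0 ?ltr_wpDl.
have [x [Ax]] := clAy _ (nbhsx_ballx y e e0).
rewrite -ball_normE /= => xy.
have {}xy : star_norm (y - x) < e by [].
have := fA x Ax; have := ler_norm_dot (y - x) fK.
rewrite linearB ler_norml => /andP[+ _]; nra.
Qed.

End Separation.

(** * Separating valid tuples *)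

Section SeparatingTuple.
Variables (R : realType) (n : nat) (b : 'rV[R]_n).
Local Notation V := 'rV[R]_n.
Implicit Types (u x y : finfct R n) (f g pi : V -> R).

Lemma I_ge0 x : I_ b x -> finfct_ge0 x.
Proof. by move=> /I_P[xnat _] p; rewrite natr_ge0. Qed.

Lemma conv_hull_I_ge0 x : conv_hull (I_ b) x -> finfct_ge0 x.
Proof.
apply: conv_hull_sub => {x} [x y t t0 t1 x0 y0 p|x]; last exact: I_ge0.
by rewrite finfctDE !finfctZE addr_ge0// mulr_ge0 ?subr_ge0.
Qed.

Lemma dot_index_sum (S : seq V) (w : 'I_(size S) -> R) u :
    uniq S -> {subset supp u <= S} ->
  dot (fun p => \sum_(j < size S | S`_j == p) w j) u = \sum_j w j * u S`_j.
Proof.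
move=> uS sub; rewrite (dotE _ uS sub) (big_nth 0) big_mkord.
apply: eq_bigr => j _; congr (_ * _).
by rewrite (big_pred1 j)// => i; rewrite nth_uniq.
Qed.

Lemma separating_weight y : finfct_ge0 y ->
    ~ minkowski_sum (conv_hull (I_ b)) (@finfct_ge0 R n) y ->
  exists pi, [/\ forall p, 0 <= pi p, dot pi y < 1 &
    forall x, I_ b x -> {subset supp x <= supp y} -> 1 <= dot pi x].
Proof.
move=> y0 yC; pose S := supp y; have uS : uniq S := supp_uniq y.
pose X := [set x | I_ b x /\ {subset supp x <= S}].
have [F [/finite_seqP[s ->] sX domX]] :=
  dickson (fun x p => Num.truncn (x p)) S X.
have sXi (i : 'I_(size s)) : X s`_i by apply: sX; exact: mem_nth.
have [i p|p|[c [c0 c1 cy]]|[w [w0 wy ws]]] :=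
  @separation R (size s) (size S) (fun i j => s`_i S`_j) (fun j => y S`_j).
- by apply: I_ge0; have [] := sXi i.
- exact: y0.
(* The combination [x] lies below [y] on the support of [y] and vanishes elsewhere, so [y - x] is
   nonnegative. *)
- exfalso; apply: yC; pose x := \sum_i c i *: s`_i.
  exists x; first by apply: conv_hull_sum => // i; apply: sub_conv_hull;
    have [] := sXi i.
  exists (y - x); last by rewrite addrC subrK.
  move=> p; rewrite finfctDE finfctNE subr_ge0 finfct_sumE.
  have [pS|pS] := boolP (p \in S).
    have := cy (Ordinal (etrans (index_mem p S) pS)).
    by rewrite /= nth_index.
  rewrite big1 => [|i _]; first exact: y0.
  have [_ sub] := sXi i; have := contra (sub p) pS.
  by rewrite mem_supp negbK finfctZE => /eqP ->; rewrite mulr0.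
- exists (fun p => \sum_(j < size S | S`_j == p) w j); split=> [p||x Ix xS].
  + exact: sumr_ge0.
  + by rewrite (dot_index_sum _ uS).
  (* The weight is nonnegative, so the bound at a dominating point passes to [x]. *)
  have [_ /nthP-/(_ 0)[i si <-] fx] := domX x (conj Ix xS).
  apply: le_trans (ws (Ordinal si)) _; rewrite (dot_index_sum _ uS)//.
  apply: ler_sum => j _; rewrite ler_wpM2l//=.
  have [/I_P[+ _] _] := sXi (Ordinal si).
  move=> /(_ S`_j)/natrP[a fE]; have := fx S`_j (mem_nth _ (ltn_ord j)).
  rewrite /= in fE; rewrite fE natrK.
  have /I_P[+ _] := Ix => /(_ S`_j)/natrP[a' ->].
  by rewrite natrK ler_nat.
Qed.

(* A weight bounded below by a positive constant has only finitely many
   integer points in its sublevel set [dot pi x < 1]; each misses the coset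
   [b + Z^n] by a positive distance, so a steep multiple of the norm makes the
   continuous part pay for the gap. *)
Lemma valid_tuple_of_weight pi (S : seq V) (e : R) : uniq S -> 0 < e ->
    (forall p, p \in S -> e <= pi p) -> (forall p, p \notin S -> pi p = 1) ->
    (forall x, I_ b x -> {subset supp x <= S} -> 1 <= dot pi x) ->
  exists L, valid_tuple b (fun r => L * enorm r) pi 1.
Proof.
move=> uS e0 piS pi1 piI; pose M := (Num.truncn e^-1).+1.
have pi0 p : 0 <= pi p.
  have [/piS|/pi1->//] := boolP (p \in S).
  exact/le_trans/ltW.
(* A nonnegative integer point supported in [S] with pairing below 1 has values below [e^-1], hence
   below [M]; so [val] covers all its possible sums. *)
pose val (h : {ffun 'I_(size S) -> 'I_M}) : V := \sum_j (h j)%:R *: S`_j.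
have /choice[L LP] (h : {ffun 'I_(size S) -> 'I_M}) : exists L, 0 <= L /\
    (val h - b \isn't a mxOver Num.int ->
      exists i, forall z, z \is a mxOver Num.int ->
        1 <= L * `|(b + z - val h) ord0 i|).
  have [hb|] := boolP (val h - b \is a mxOver Num.int); first by exists 0.
  have [/'forall_forallP hint /mxOverP[]//|] :=
    boolP [forall i, forall j, (val h - b) i j \is a Num.int].
  move=> /forallPn[i0] /forallPn[i]; rewrite (ord1 i0) => hi _.
  have [|L L0 LP] := @int_translate_bounded R ((b - val h) ord0 i).
    by rewrite -opprB mxE rpredN.
  exists L; split=> // _; exists i => z /mxOverP zint.
  by have := LP _ (zint ord0 i); rewrite !mxE addrAC.
exists (\sum_h L h); split=> [|s x]; first by rewrite !inE eqxx !orbT.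
move=> [/= s0 xnat [z zint sxE]].
have x0 : finfct_ge0 x by move=> p; rewrite natr_ge0.
have L0 : 0 <= \sum_h L h by apply: sumr_ge0 => h _; have [] := LP h.
rewrite tuple_lhsE.
have s1 : 0 <= dot (fun r => (\sum_h L h) * enorm r) s.
  by apply: dot_ge0 => // r; rewrite mulr_ge0 ?enorm_ge0.
have x1 := dot_ge0 pi0 x0.
(* Off [S] the weight is 1, and a nonzero natural value there already contributes 1. *)
have [xS|] := pselect {subset supp x <= S}; last first.
  move=> /existsNP[p /not_implyP[px /negP pS]].
  have := ler_dot_term p pi0 x0; rewrite (pi1 p pS) mul1r.
  move: px; rewrite mem_supp; have /natrP[a ->] := xnat p.
  rewrite pnatr_eq0 -lt0n -(ler1n R); lra.
have [|xlt] := lerP 1 (dot pi x).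
  by move=> ?; rewrite ler_wpDl.
have xM p : p \in S -> (Num.truncn (x p) < M)%N.
  move=> pS; have := ler_dot_term p pi0 x0; have := piS p pS => ep fx.
  rewrite truncn_lt_nat; last exact: x0.
  have : x p < e^-1.
    rewrite -[ltRHS]mul1r ltr_pdivlMr// mulrC.
    apply: le_lt_trans xlt; apply: le_trans fx.
    by rewrite ler_wpM2r//; exact: x0.
  by move=> /lt_trans; apply; exact: truncnS_gt.
pose h := [ffun j : 'I_(size S) =>
  Ordinal (xM _ (mem_nth 0 (ltn_ord j)))].
have hE : val h = lsum id x.
  rewrite (lsumE _ uS xS) (big_nth 0) big_mkord; apply: eq_bigr => j _.
  by rewrite ffunE /= truncnK.
(* If [val h - b] were integral, [x] would be in [I_ b] with pairing below 1, against [piI]. *)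
have [Lh0 LhP] := LP h; have [|i /(_ z zint)] := LhP.
  rewrite hE; apply/negP => xint.
  have /(piI x) : I_ b x by apply/I_P.
  by move=> /(_ xS); rewrite leNgt xlt.
rewrite hE -sxE => Li.
apply: (le_trans Li); apply: ler_wpDr => //.
have -> : dot (fun r => (\sum_h L h) * enorm r) s =
    (\sum_h L h) * dot (@enorm R n) s.
  rewrite /dot mulr_fsumr; apply: eq_fsbigr => r _; by rewrite mulrA.
apply: ler_pM => //.
  by rewrite (bigD1 h)//= lerDl sumr_ge0// => h' _; have [] := LP h'.
have -> : \sum_(r \in [set: V]) s r *: r + \sum_(p \in [set: V]) x p *: p -
    lsum id x = lsum id s by rewrite [LHS]addrK.
exact: ler_norm_lsum.
Qed.

Lemma separating_tuple y : finfct_ge0 y ->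
    ~ minkowski_sum (conv_hull (I_ b)) (@finfct_ge0 R n) y ->
  exists L pi, valid_tuple b (fun r => L * enorm r) pi 1 /\ dot pi y < 1.
Proof.
move=> y0 yC; have [w [w0 wy wI]] := separating_weight y0 yC.
pose T := dot (fun=> 1) y; have T0 : 0 <= T by exact: dot_ge0.
(* Raising the weight by [e] on the support of [y] costs [e * T], strictly less than the slack
   [1 - dot w y]. *)
pose e := (1 - dot w y) / (1 + T).
have eT : e * (1 + T) = 1 - dot w y by rewrite /e mulfVK//; lra.
have e0 : 0 < e by rewrite divr_gt0 ?subr_gt0 ?ltr_wpDr.
pose pi p := if p \in supp y then w p + e else 1.
have piE u : {subset supp u <= supp y} ->
    dot pi u = dot w u + e * dot (fun=> 1) u.
  move=> sub; rewrite !(dotE _ (supp_uniq y) sub) mulr_sumr -big_split/=.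
  rewrite big_seq [RHS]big_seq; apply: eq_bigr => p py.
  by rewrite /pi py mul1r mulrDl.
have [||p py|p /negPf py|x Ix xy|L LP] :=
    @valid_tuple_of_weight pi (supp y) e.
- exact: supp_uniq.
- exact: e0.
- by rewrite /pi py lerDr.
- by rewrite /pi py.
- rewrite piE//; apply: le_trans (wI x Ix xy) _.
  rewrite lerDl mulr_ge0 ?(ltW e0)// dot_ge0//; exact: I_ge0.
exists L, pi; split=> //; rewrite piE// -/T; nra.
Qed.

Lemma sub_G : conv_hull (I_ b) `<=` G_ b.
Proof.
apply: conv_hull_sub => [x y t t0 t1 [_ /= x0 xQ] [_ /= y0 yQ]|x Ix].
  split=> //= [p|psi pi a va].
    by rewrite finfctDE !finfctZE addr_ge0// mulr_ge0 ?subr_ge0.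
  have := xQ _ _ _ va; have := yQ _ _ _ va; rewrite !tuple_lhsE.
  rewrite linear0 !add0r linearD !linearZ /=; nra.
split=> //=; first exact: I_ge0.
by move=> psi pi a [_]; apply.
Qed.

Lemma G_sub : G_ b `<=` minkowski_sum (conv_hull (I_ b)) (@finfct_ge0 R n).
Proof.
move=> y [_ /= y0 yQ]; apply: contrapT => /(separating_tuple y0)[L [pi [vpi]]].
by have := yQ _ _ _ vpi; rewrite tuple_lhsE linear0 add0r leNgt => /negP.
Qed.

(** Points of the hull near [y] may have support outside that of [y]. Using the continuous
    coefficients of the tuple there gives a single function [f], which agrees with [pi] on the
    support of [y] and is bounded for the star norm. *)
Lemma closure_sub : closure (conv_hull (I_ b)) `<=`
  minkowski_sum (conv_hull (I_ b)) (@finfct_ge0 R n).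
Proof.
move=> y cly; have y0 : finfct_ge0 y.
  (* Evaluation at [p] is continuous for the star norm, so nonnegativity passes to the closure. *)
  move=> p; rewrite -dot_pred1.
  have [q|K KP] := @enorm_bound R n (fun q => (q == p)%:R) [:: p] 0.
    by rewrite inE mul0r => /negPf ->.
  apply: (closure_dot_ge KP _ cly) => x Cx; rewrite dot_pred1.
  exact: conv_hull_I_ge0.
apply: contrapT => /(separating_tuple y0)[L [pi [[_ vpi]]]].
pose D : pred V := mem (supp y); pose f p := if D p then pi p else L * enorm p.
have -> : dot pi y = dot f y.
  rewrite !(dotE _ (supp_uniq y) (fun _ => id)) big_seq [RHS]big_seq.
  by apply: eq_bigr => p py; rewrite /f /D /= py.
apply/negP; rewrite -leNgt.
have [p|K KP] := @enorm_bound R n f (supp y) L.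
  by rewrite /f /D /= => /negPf ->.
apply: (closure_dot_ge KP _ cly).
apply: conv_hull_sub => [x x' t t0 t1 fx fx'|x Ix].
  by rewrite linearD !linearZ /=; nra.
have x0 := I_ge0 Ix; have /I_P[xnat xint] := Ix.
(* The part of [x] off the support of [y] is moved to the continuous component; the sum of both
   parts is unchanged. *)
have : M_ b (finrestr (predC D) x, finrestr D x).
  split=> [p|p|] /=.
  - by case: ifP.
  - by case: ifP.
  exists (lsum id x - b) => //; rewrite [RHS]addrC subrK.
  by rewrite -[in RHS](finrestrDC D x) linearD.
move=> /vpi; rewrite tuple_lhsE => /le_trans; apply.
rewrite !dot_finrestr !(dotE _ (supp_uniq x) (fun _ => id)) -big_split/=.
apply: ler_sum => p _; rewrite /f.
by case: (D p); rewrite mul0r ?addr0 ?add0r.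
Qed.

End SeparatingTuple.

(** * Equality of the four sets *)

Unset Implicit Arguments.

Theorem corollary5p3 (R : realType) (n : nat) (b : 'rV[R]_n)
    (hb : b \isn't a mxOver Num.int) :
  [/\ conv_hull (I_ b) = G_ b `&` aff_hull (I_ b),
      G_ b `&` aff_hull (I_ b) =
        closure (conv_hull (I_ b)) `&` aff_hull (I_ b) &
      closure (conv_hull (I_ b)) `&` aff_hull (I_ b) =
        minkowski_sum (conv_hull (I_ b)) (@finfct_ge0 R n)
          `&` aff_hull (I_ b)].
Proof.
set C := conv_hull _; set A := aff_hull _; set P := minkowski_sum _ _.
have CA : C `<=` A := @conv_hull_sub_aff_hull _ _ _.
have CP : C `<=` P.
  by move=> x Cx; exists x => //; exists 0; rewrite ?addr0// => p; exact: lexx.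
have PA : P `&` A `<=` C := @minkowski_sum_aff_hull_sub _ _ _.
have sandwich B : C `<=` B -> B `<=` P -> B `&` A = C.
  move=> CB BP; apply/seteqP; split=> [x [Bx Ax]|x Cx].
    by apply: PA; split=> //; exact: BP.
  by split; [exact: CB|exact: CA].
have GE := sandwich _ (@sub_G _ _ b) (@G_sub _ _ b).
have clE := sandwich _ (@subset_closure _ C) (@closure_sub _ _ b).
by rewrite (sandwich P)// GE clE.
Qed.
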